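(* There does not exist a Seidel matrix $S$ with characteristic polynomial $\chi_S(x)=(x+5)^{33}(x-7)(x-9)^{9}(x-11)^7$.
   Context: A Seidel matrix is a symmetric matrix with all diagonal entries $0$ and all off-diagonal entries $\pm1$. For a square matrix $M$, $\chi_M(x)=\det(xI-M)$. *)

(* Defs.v *)
From HB Require Import structures.
From mathcomp Require Import all_boot all_order all_algebra.
Set Implicit Arguments.
Unset Strict Implicit.
Unset Printing Implicit Defensive.
Import Order.TTheory GRing.Theory Num.Theory.
Local Open Scope ring_scope.

Definition seidel_matrix (R : numDomainType) (n : nat) (S : 'M[R]_n) : Prop :=
  [/\ S^T = S,
      forall i : 'I_n, S i i = 0
    & forall i j : 'I_n, i != j -> S i j = 1 \/ S i j = -1].

(* Main.v *)
Require Import Defs.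
From HB Require Import structures.
From mathcomp Require Import all_boot all_order all_algebra all_field.
From mathcomp Require Import ring zify.
Set Implicit Arguments.
Unset Strict Implicit.
Unset Printing Implicit Defensive.
Import Order.TTheory GRing.Theory Num.Theory.
Local Open Scope ring_scope.

(* Suppose S has this characteristic polynomial; then n = 50 and S may be taken
   over the integers.  With P_t the orthogonal projection onto the t-eigenspace,
   M = (S + 5)(S - 9)(S - 11) = 96 P_7 and K = -(S + 5)(S - 7)(S - 11) = 56 P_9
   are integral and positive semidefinite, K_ii = 12 - M_ii, tr M = 96, and
   M_ij^2 = M_ii M_jj as P_7 has rank one.  Writing the entries of S as
   1 - 2 a_ij off the diagonal and expanding S^2 and S^3 modulo 8 yields
   M_ii = 4 mu_i with 0 <= mu_i <= 3, 4 | M_ij and K = 4 G with G integral and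
   G_ij = (1 + mu_i)(1 + mu_j) mod 2.  As mu_i mu_j is a square, the nonzero
   mu_i share one value c.  Now sum_j G_ij^2 = 14 G_ii = 14 (3 - mu_i):
   - c = 2: all entries of G are odd, but a row with mu_i = 2 has 14 < 50;
   - c = 3: eight indices have mu_i = 3; in a row with mu_i = 0 the diagonal
     entry is 3 and 41 others are odd, but 9 + 41 > 42;
   - c = 1: 24 indices are inside (mu_i = 1), 26 outside.  An inside row has
     exactly 7 nonzero entries, all +-2, an even number of them (by K M = 0) in
     inside columns; an outside row has at most two nonzero entries in inside
     columns.  Inside vectors with nonzero inner product are proportional, so
     every inside index has at least 5 outside neighbours: 24 * 5 > 26 * 2. *)

(** * Diagonalization of real symmetric matrices *)

Lemma prod_XsubC_perm_eq (F : idomainType) (rs ts : seq F) :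
  \prod_(z <- rs) ('X - z%:P) = \prod_(z <- ts) ('X - z%:P) -> perm_eq rs ts.
Proof.
elim: rs ts => [|r rs IH] ts eqp.
  by move/(congr1 (size \o polyseq)): eqp; rewrite /= !size_prod_XsubC; case: ts.
have r_ts : r \in ts.
  by rewrite -root_prod_XsubC -eqp root_prod_XsubC mem_head.
rewrite perm_sym (permPl (perm_to_rem r_ts)) perm_cons perm_sym; apply: IH.
move: eqp; rewrite big_cons (perm_big _ (perm_to_rem r_ts)) big_cons /=.
by apply: mulfI; rewrite polyXsubC_eq0.
Qed.

Lemma char_poly_conj (F : fieldType) n (P A : 'M[F]_n) :
  P \in unitmx -> char_poly (invmx P *m A *m P) = char_poly A.
Proof.
move=> Pu; rewrite /char_poly.
have -> : char_poly_mx (invmx P *m A *m P)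
    = map_mx polyC (invmx P) *m char_poly_mx A *m map_mx polyC P.
  rewrite /char_poly_mx mulmxBr mulmxBl !map_mxM; congr (_ - _).
  by rewrite scalar_mxC -mulmxA -map_mxM mulVmx // map_mx1 mulmx1.
rewrite !det_mulmx mulrAC -det_mulmx -map_mxM mulVmx //.
by rewrite map_mx1 det1 mul1r.
Qed.

Section SymmetricSpectrum.

Variables (n : nat) (A : 'M[algC]_n.+1) (rs : seq algC).
Hypotheses (symA : A^T = A) (realA : A \is a mxOver Num.real).
Hypothesis charA : char_poly A = \prod_(z <- rs) ('X - z%:P).

(** A real symmetric matrix is normal, so the spectral theorem applies; comparing factorizations of
    [char_poly A] identifies the diagonal with [rs]. *)
Lemma symmetric_diagonalization : exists P : 'M[algC]_n.+1, exists d : 'rV_n.+1,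
  [/\ P \in unitmx, A = invmx P *m diag_mx d *m P
    & perm_eq [seq d 0 i | i : 'I_n.+1] rs].
Proof.
have normA : A \is normalmx.
  apply: symmetric_normalmx => //.
  by rewrite qualifE /= expr0 scale1r map_mx_id // symA.
exists (spectralmx A), (spectral_diag A); have Pu := spectral_unit A.
have eqA := orthomx_spectralP normA; split=> //.
apply: prod_XsubC_perm_eq; rewrite -charA {2}eqA char_poly_conj //.
rewrite char_poly_trig ?diag_mx_is_trig // big_image /=.
by apply: eq_bigr => i _; rewrite mxE eqxx.
Qed.

Lemma trace_horner_mx (q : {poly algC}) :
  \tr (horner_mx A q) = \sum_(z <- rs) q.[z].
Proof.
have [P [d [Pu eqA dP]]] := symmetric_diagonalization.
rewrite {1}eqA horner_mx_uconjC // mxtrace_mulC mulmxA mulmxV // mul1mx.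
rewrite horner_mx_diag mxtrace_diag -(perm_big _ dP) big_image /=.
by apply: eq_bigr => i _; rewrite mxE.
Qed.

(** Diagonalizability makes multiplicities irrelevant: a simple zero of [q] at each eigenvalue
    suffices. *)
Lemma horner_mx_roots_eq0 (q : {poly algC}) :
  all (root q) rs -> horner_mx A q = 0.
Proof.
have [P [d [Pu eqA dP]]] := symmetric_diagonalization.
rewrite -(perm_all _ dP) => /allP q0.
rewrite eqA horner_mx_uconjC // horner_mx_diag.
suff -> : map_mx (horner q) d = 0 by rewrite raddf0 mulmx0 mul0mx.
apply/rowP => i; rewrite !mxE.
by apply/eqP/q0/mapP; exists i => //; rewrite mem_enum.
Qed.

End SymmetricSpectrum.

(** * Integer symmetric matrices, embedded into the algebraic numbers *)

Section IntSymmetricSpectrum.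

Variables (n : nat) (S : 'M[int]_n.+1) (rs : seq int).
Hypotheses (symS : S^T = S).
Hypothesis charS : char_poly S = \prod_(z <- rs) ('X - z%:P).

Let SC : 'M[algC]_n.+1 := map_mx intr S.
Let rsC : seq algC := map intr rs.

Let symSC : SC^T = SC.
Proof. by rewrite /SC map_trmx symS. Qed.

Let realSC : SC \is a mxOver Num.real.
Proof. by apply/mxOverP => i j; rewrite mxE realz. Qed.

Let charSC : char_poly SC = \prod_(z <- rsC) ('X - z%:P).
Proof. by rewrite -map_char_poly charS map_prod_XsubC big_map. Qed.

Lemma int_trace_horner_mx (q : {poly int}) :
  \tr (horner_mx S q) = \sum_(z <- rs) q.[z].
Proof.
apply: (@intr_inj algC); rewrite -trace_map_mx map_horner_mx /=.
rewrite (trace_horner_mx symSC realSC charSC) big_map rmorph_sum /=.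
by apply: eq_bigr => z _; rewrite horner_map.
Qed.

Lemma int_horner_mx_roots_eq0 (q : {poly int}) :
  all (root q) rs -> horner_mx S q = 0.
Proof.
move=> /allP q0; suff : map_mx intr (horner_mx S q) = 0 :> 'M[algC]_n.+1.
  move/matrixP => eq0; apply/matrixP => i j; apply/eqP.
  by rewrite mxE -(intr_eq0 algC); have := eq0 i j; rewrite !mxE => /eqP.
rewrite map_horner_mx; apply: (horner_mx_roots_eq0 symSC realSC charSC).
apply/allP => _ /mapP[z /q0/rootP qz ->].
by apply/rootP; rewrite horner_map qz rmorph0.
Qed.

End IntSymmetricSpectrum.

(** * Integer multiples of orthogonal projections *)

Section ScaledProjection.

Variables (n : nat) (X : 'M[int]_n) (c : int).
Hypotheses (symX : X^T = X) (sqX : X *m X = c *: X) (c_gt0 : 0 < c).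

Let symXE i j : X j i = X i j.
Proof. by rewrite -[in LHS]symX mxE. Qed.

Lemma scaled_proj_sumE i j : \sum_k X i k * X j k = c * X i j.
Proof.
have /matrixP/(_ i j) := sqX; rewrite !mxE => <-.
by apply: eq_bigr => k _; rewrite (symXE k j).
Qed.

(** The rows of [X] have Gram matrix [c *: X]; both sides are the squared norm of [x] times row [i]
    plus [y] times row [j]. *)
Lemma scaled_proj_form i j x y :
  \sum_k (x * X i k + y * X j k) ^+ 2
  = c * (x ^+ 2 * X i i + 2 * x * y * X i j + y ^+ 2 * X j j).
Proof.
transitivity (x ^+ 2 * (\sum_k X i k * X i k)
  + 2 * x * y * (\sum_k X i k * X j k) + y ^+ 2 * (\sum_k X j k * X j k)).
  by rewrite !mulr_sumr -!big_split /=; apply: eq_bigr => k _; ring.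
by rewrite !scaled_proj_sumE; ring.
Qed.

Lemma scaled_proj_ge0 i j x y :
  0 <= x ^+ 2 * X i i + 2 * x * y * X i j + y ^+ 2 * X j j.
Proof.
rewrite -(pmulr_rge0 _ c_gt0) -scaled_proj_form.
by apply: sumr_ge0 => k _; apply: sqr_ge0.
Qed.

Lemma scaled_proj_diag_ge0 i : 0 <= X i i.
Proof. by have := scaled_proj_ge0 i i 1 0; lia. Qed.

Lemma scaled_proj_CauchySchwarz i j : X i j ^+ 2 <= X i i * X j j.
Proof.
(* With these coefficients the form equals X_jj (X_ii X_jj - X_ij^2). If X_jj = 0, row [j] has norm
   0 and vanishes. *)
have := scaled_proj_ge0 i j (X j j) (- X i j).
have := scaled_proj_diag_ge0 j; rewrite le_eqVlt => /orP[/eqP Xjj0 _|Xjj_gt0].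
  have := scaled_proj_sumE j j; rewrite -Xjj0 mulr0 => /eqP.
  rewrite psumr_eq0 => [/allP/(_ i)|k _]; last by rewrite -expr2 sqr_ge0.
  by rewrite mem_index_enum symXE => /(_ isT)/=; rewrite mulf_eq0 orbb => /eqP->; lia.
by nia.
Qed.

(* Trace [c] means rank one: then the sums of both sides of Cauchy-Schwarz agree. *)
Lemma scaled_proj_rank1 i j : \tr X = c -> X i j ^+ 2 = X i i * X j j.
Proof.
move=> trX; pose D a b := X a a * X b b - X a b ^+ 2.
have D_ge0 a b : 0 <= D a b by rewrite subr_ge0 scaled_proj_CauchySchwarz.
have : \sum_a \sum_b D a b = 0.
  transitivity (\sum_a (c * X a a - c * X a a)); last first.
    by rewrite big1 // => a _; rewrite subrr.
  apply: eq_bigr => a _; rewrite /D sumrB -mulr_sumr -[\sum_i _]/(\tr X) trX mulrC.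
  by congr (_ - _); rewrite -scaled_proj_sumE; apply: eq_bigr => b _; rewrite expr2.
move/eqP; rewrite psumr_eq0 => [/allP/(_ i)|a _]; last exact: sumr_ge0.
rewrite mem_index_enum => /(_ isT)/=.
rewrite psumr_eq0 => [/allP/(_ j)|//]; rewrite mem_index_enum => /(_ isT)/=.
by rewrite subr_eq0 => /eqP.
Qed.

End ScaledProjection.

(** * Congruences for symmetric sign matrices *)

Lemma sqr_mod2 (x : int) : exists w, x ^+ 2 = x + 2 * w.
Proof.
have [xE|xE] : x = 2 * (x %/ 2)%Z \/ x = 2 * (x %/ 2)%Z + 1 by lia.
  by move: (x %/ 2)%Z xE => q ->; exists (2 * q ^+ 2 - q); ring.
by move: (x %/ 2)%Z xE => q ->; exists (2 * q ^+ 2 + q); ring.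
Qed.

Section SignMatrix.

Variables (n : nat) (a : 'I_n -> 'I_n -> int).
Hypothesis syma : forall i j, a i j = a j i.

Let deg i := \sum_j a i j.

Lemma sign_square_mod4 i j : exists z,
  \sum_k (1 - 2 * a i k) * (1 - 2 * a j k) = n%:Z - 2 * deg i - 2 * deg j + 4 * z.
Proof.
exists (\sum_k a i k * a j k).
have -> : n%:Z = \sum_(k < n) 1 by rewrite sumr_const card_ord natz.
rewrite !mulr_sumr -!sumrB -!big_split /=; apply: eq_bigr => k _; ring.
Qed.

Lemma sign_cube_mod8 i : exists z,
  \sum_j \sum_k (1 - 2 * a i j) * (1 - 2 * a j k) * (1 - 2 * a k i)
  = n%:Z ^+ 2 - 4 * n%:Z * deg i - 2 * (\sum_j deg j) + 4 * deg i ^+ 2 + 8 * z.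
Proof.
pose s := \sum_j \sum_k a i j * a j k.
have sE : \sum_j \sum_k a j k * a k i = s.
  rewrite exchange_big; apply: eq_bigr => j _; apply: eq_bigr => k _ /=.
  by rewrite mulrC (syma j i) (syma k j).
have one : \sum_(k < n) 1 = n%:Z by rewrite sumr_const card_ord natz.
have e1 : n%:Z ^+ 2 = \sum_(j < n) \sum_(k < n) 1.
  by under eq_bigr do rewrite one; rewrite sumr_const card_ord; lia.
have e2 : n%:Z * deg i = \sum_(j < n) \sum_(k < n) a i j.
  rewrite /deg mulr_sumr; apply: eq_bigr => j _.
  by rewrite sumr_const card_ord; lia.
have e3 : n%:Z * deg i = \sum_(j < n) \sum_(k < n) a k i.
  rewrite exchange_big /= e2; apply: eq_bigr => j _.
  by apply: eq_bigr => k _; rewrite syma.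
have e4 : deg i ^+ 2 = \sum_j \sum_k a i j * a k i.
  rewrite expr2 {1}/deg mulr_suml; apply: eq_bigr => j _.
  by rewrite mulr_sumr; apply: eq_bigr => k _; rewrite (syma k i).
(* By symmetry the path sums a_ij a_jk and a_jk a_ki both equal [s], so together they contribute 8
   [s]. *)
exists (s - \sum_j \sum_k a i j * a j k * a k i).
transitivity (\sum_(j < n) \sum_(k < n) 1 - 2 * (\sum_j \sum_(k < n) a i j)
  - 2 * (\sum_(j < n) \sum_k a k i) - 2 * (\sum_j deg j)
  + 4 * (\sum_j \sum_k a i j * a k i) + 4 * s
  + 4 * (\sum_j \sum_k a j k * a k i)
  - 8 * (\sum_j \sum_k a i j * a j k * a k i)); last first.
  by rewrite -e1 -e2 -e3 -e4 sE; ring.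
rewrite /s !mulr_sumr -!sumrB -!big_split -sumrB; apply: eq_bigr => j _ /=.
by rewrite !mulr_sumr -!sumrB -!big_split -sumrB; apply: eq_bigr => k _ /=; ring.
Qed.

End SignMatrix.

(** * Combinatorial contradiction from the Gram matrix G *)

Section OddGram.

Variables (n : nat) (G P : 'M[int]_n) (mu : 'I_n -> int).
Hypotheses (n50 : n = 50%N) (symG : G^T = G) (sqG : G *m G = 14 *: G).
Hypothesis GP0 : forall i j, \sum_k G i k * P j k = 0.
Hypothesis mu_bounds : forall i, 0 <= mu i <= 3.
Hypothesis sum_mu : \sum_i mu i = 24.
Hypothesis PE : forall i j, P i j ^+ 2 = mu i * mu j.
Hypothesis Gdiag : forall i, G i i = 3 - mu i.
Hypothesis G_mod2 : forall i j, exists z,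
  G i j = (1 + mu i) * (1 + mu j) + 2 * z.

Let symGE i j : G j i = G i j.
Proof. by rewrite -[in LHS]symG mxE. Qed.

Let normG i : \sum_k G i k ^+ 2 = 14 * (3 - mu i).
Proof.
rewrite -Gdiag -(scaled_proj_sumE symG sqG).
by apply: eq_bigr => k _; rewrite expr2.
Qed.

Let sum_const (c : int) : \sum_(i < n) c = 50 * c.
Proof. by rewrite sumr_const card_ord n50; lia. Qed.

Let sum_delta (i : 'I_n) (c : int) : \sum_j (if j == i then c else 0) = c.
Proof. by rewrite -big_mkcond big_pred1_eq. Qed.

Let mu_eq i j : mu i != 0 -> mu j != 0 -> mu i = mu j.
Proof.
move=> mui muj; have := PE i j; have := mu_bounds i; have := mu_bounds j.
move: (P i j) (mu i) (mu j) mui muj => x u v u0 v0 uB vB xE.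
(* The products 2, 3 and 6 of distinct values in {1, 2, 3} are not squares. *)
have xB : [\/ x ^+ 2 = 0, x ^+ 2 = 1, x ^+ 2 = 4 | 9 <= x ^+ 2].
  have [x2|[x2|[x2|x2]]] : x = 0 \/ `|x| = 1 \/ `|x| = 2 \/ 3 <= `|x| by lia.
  - by constructor 1; rewrite x2.
  - by constructor 2; rewrite -real_normK ?num_real // x2.
  - by constructor 3; rewrite -real_normK ?num_real // x2.
  - by constructor 4; rewrite -real_normK ?num_real //; nia.
have [uE | [uE | uE]] : u = 1 \/ u = 2 \/ u = 3 by lia.
all: have [vE | [vE | vE]] : v = 1 \/ v = 2 \/ v = 3 by lia.
all: by subst u v; case: xB => xE2; lia.
Qed.

Let mu_neq2 i : mu i = 2 -> False.
Proof.
move=> mui; have : \sum_(j < n) 1 <= \sum_j G i j ^+ 2.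
  apply: ler_sum => j _; have [z] := G_mod2 i j; rewrite mui.
  have [->|muj] := eqVneq (mu j) 0; first by nia.
  by rewrite -(@mu_eq i j) ?mui //; nia.
by rewrite normG sum_const mui.
Qed.

Let mu_neq3 i : mu i = 3 -> False.
Proof.
move=> mui; have [j /eqP muj] : exists j, mu j == 0.
  apply/existsP; rewrite -[[exists _, _]]negbK negb_exists; apply/negP => /forallP mu0.
  have : \sum_(j < n) 3 = \sum_j mu j.
    by apply: eq_bigr => j _; rewrite -(@mu_eq i j) ?mui //; apply: mu0.
  by rewrite sum_const sum_mu.
(* The row norm is tripled so that the bound is linear in [mu]: 3 where [mu] is 0, and 0 where it is
   3. The extra 24 accounts for 3 * 9 on the diagonal. Summing gives 150 <= 126. *)
have : \sum_k (3 - mu k + (if k == j then 24 else 0)) <= \sum_k 3 * G j k ^+ 2.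
  apply: ler_sum => k _; have [->|_] := eqVneq k j; first by rewrite Gdiag muj.
  have [z] := G_mod2 j k; rewrite muj; have := mu_bounds k.
  have [->|muk] := eqVneq (mu k) 0; first by nia.
  by rewrite -(@mu_eq i k) ?mui //; nia.
by rewrite -mulr_sumr big_split sumrB /= sum_const sum_mu sum_delta normG muj.
Qed.

Let mu01 i : mu i = 0 \/ mu i = 1.
Proof.
have := mu_bounds i; have := @mu_neq2 i; have := @mu_neq3 i; lia.
Qed.

(* [b] is the adjacency of nonorthogonal Gram vectors; [s i] and [t i] count the
   neighbours of [i] with [mu] equal to 1 and 0. *)
Let b i j : int := (G i j != 0)%:R.

Let b_sym i j : b i j = b j i.
Proof. by rewrite /b symGE. Qed.

Let b01 i j : b i j = 0 \/ b i j = 1.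
Proof. by rewrite /b; case: (G i j != 0); [right | left]. Qed.

Let s i := \sum_k mu k * b i k.
Let t i := \sum_k (1 - mu k) * b i k.

(** The row has squared norm 42: the diagonal gives 9, each of the 25 other outside entries is odd
    and gives at least 1, and each inside neighbour at least 4. So 34 + 4 [s j] <= 42. *)
Let outside_degree j : mu j = 0 -> s j <= 2.
Proof.
move=> muj; have : \sum_k (1 - mu k + (if k == j then 8 else 0) + 4 * (mu k * b j k))
    <= \sum_k G j k ^+ 2.
  apply: ler_sum => k _; have [->|_] := eqVneq k j.
    by rewrite Gdiag muj mul0r.
  have [z] := G_mod2 j k; rewrite muj /b; case: (mu01 k) => ->; first by nia.
  have [->|Gjk] /= := eqVneq (G j k) 0; first by [].
  move=> Gz; suff : 4 <= G j k ^+ 2 by lia.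
  have [?|?] : 2 <= G j k \/ G j k <= -2 by lia.
    by rewrite expr2; nia.
  by rewrite expr2; nia.
rewrite !big_split sumrN /= sum_const sum_mu sum_delta normG muj -mulr_sumr.
by rewrite -/(s j); move: (s j); lia.
Qed.

(** The entry is even, and positivity of the form at (1, 1) and (1, -1) gives 2 |G_ij| <= G_ii +
    G_jj <= 5. *)
Let inside_entry i j : mu i = 1 -> G i j ^+ 2 = 4 * b i j.
Proof.
move=> mui; have [z] := G_mod2 i j; rewrite mui /b.
have := scaled_proj_ge0 symG sqG isT i j 1 1.
have := scaled_proj_ge0 symG sqG isT i j 1 (-1).
have := mu_bounds j; rewrite !Gdiag mui.
case: (eqVneq (G i j) 0) => /= [->|Gij] *; first by [].
have [->|->] : G i j = 2 \/ G i j = -2 by lia.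
all: by [].
Qed.

Let inside_total i : mu i = 1 -> \sum_k b i k = 7.
Proof.
move=> mui; have := normG i; rewrite mui.
under eq_bigr do rewrite inside_entry //.
by rewrite -mulr_sumr; move: (\sum_k b i k); lia.
Qed.

(** In the vanishing sum of G_ik P_ik, each inside neighbour contributes +-2, which is 2 mod 4, and
    all other terms are 0. Hence 4 divides 2 [s i]. *)
Let inside_even i : mu i = 1 -> exists z, s i = 2 * z.
Proof.
move=> mui.
have e k : exists z, G i k * P i k = 2 * (mu k * b i k) + 4 * z.
  have := PE i k; have := inside_entry k mui; rewrite mui.
  move: (G i k) (P i k) => g p; case: (mu01 k) => ->; case: (b01 i k) => -> gE pE.
  - by exists 0; nia.
  - by exists 0; nia.
  - by exists 0; nia.
  - have [->|->] : g = 2 \/ g = -2 by nia.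
    + by have [->|->] : p = 1 \/ p = -1; [nia | exists 0 | exists (-1)].
    + by have [->|->] : p = 1 \/ p = -1; [nia | exists (-1) | exists 0].
have e' k : 2 * (mu k * b i k)
    = G i k * P i k - 4 * ((G i k * P i k - 2 * (mu k * b i k)) %/ 4)%Z.
  by have [z ->] := e k; lia.
exists (- \sum_k ((G i k * P i k - 2 * (mu k * b i k)) %/ 4)%Z).
suff : 2 * s i = - (4 * \sum_k ((G i k * P i k - 2 * (mu k * b i k)) %/ 4)%Z).
  by move: (\sum_k _) (s i) => x y; lia.
rewrite /s mulr_sumr; under eq_bigr do rewrite e'.
by rewrite sumrB GP0 sub0r mulr_sumr.
Qed.

(** With G_ik = 2e and e = +-1, row [i] minus e times row [k] has squared norm 14 (2 - 4 + 2) = 0,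
    so the two rows have the same support. *)
Let inside_twin i k j : mu i = 1 -> mu k = 1 -> b i k = 1 -> b i j = b k j.
Proof.
move=> mui muk bik; have := inside_entry k mui; rewrite bik mulr1 => Gik.
have [e [e1 GE]] : exists e, e ^+ 2 = 1 /\ G i k = 2 * e.
  have [->|->] : G i k = 2 \/ G i k = -2 by nia.
  - by exists 1.
  - by exists (-1).
have := scaled_proj_form symG sqG i k 1 (- e).
have -> : 14 * (1 ^+ 2 * G i i + 2 * 1 * - e * G i k + (- e) ^+ 2 * G k k) = 0.
  by rewrite !Gdiag mui muk GE; lia.
move/eqP; rewrite psumr_eq0 => [/allP/(_ j)|l _]; last exact: sqr_ge0.
rewrite mem_index_enum => /(_ isT)/=; rewrite sqrf_eq0 mul1r mulNr subr_eq0 => /eqP.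
rewrite /b => ->; rewrite mulf_eq0.
by have -> : (e == 0) = false by lia.
Qed.

(** As [s i] + [t i] = 7 with [s i] even, some outside [j] is a neighbour of [i]. By [inside_twin],
    every inside neighbour of [i] is also one of [j], so [s i] <= [s j] <= 2. *)
Let inside_outside i : mu i = 1 -> 5 <= t i.
Proof.
move=> mui; have st : s i + t i = 7.
  rewrite -(inside_total mui) /s /t -big_split; apply: eq_bigr => k _ /=; ring.
have [z sE] := inside_even mui.
have [j] : exists j, (mu j == 0) && (b i j == 1).
  apply/existsP; rewrite -[[exists _, _]]negbK negb_exists; apply/negP => /forallP none.
  have : t i = 0; last by lia.
  apply: big1 => j _; have := none j; case: (mu01 j) => ->; case: (b01 i j) => -> //.
case/andP => /eqP muj /eqP bij.
suff : s i <= 2 by lia.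
apply: le_trans (outside_degree muj); apply: ler_sum => k _.
case: (mu01 k) => muk; rewrite muk; first by lia.
case: (b01 i k) => bik; rewrite bik; first by case: (b01 j k); lia.
by rewrite b_sym -(inside_twin _ mui muk bik) bij.
Qed.

Lemma odd_gram_false : False.
Proof.
have : \sum_i mu i * 5 <= \sum_i mu i * t i.
  apply: ler_sum => i _; case: (mu01 i) => mui; rewrite mui ?mul0r // !mul1r.
  exact: inside_outside.
(* Both sums count the inside-outside adjacencies; the two bounds then give 120 <= 52. *)
have -> : \sum_i mu i * t i = \sum_j (1 - mu j) * s j.
  rewrite /s /t; under eq_bigr do rewrite mulr_sumr.
  rewrite exchange_big; apply: eq_bigr => j _ /=; rewrite mulr_sumr.
  by apply: eq_bigr => i _; rewrite b_sym; ring.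
have : \sum_j (1 - mu j) * s j <= \sum_j (1 - mu j) * 2.
  apply: ler_sum => j _; case: (mu01 j) => muj.
    by rewrite muj subr0 !mul1r; apply: outside_degree.
  by rewrite muj subrr !mul0r.
by rewrite -!mulr_suml sumrB sum_const sum_mu; lia.
Qed.

End OddGram.

(** * Powers of a Seidel matrix of order 50 modulo 8 *)

Lemma horner_mx_cubicE n (S : 'M[int]_n.+1) (q : {poly int}) (c3 c2 c1 c0 : int) i j :
  q = c3%:~R * 'X ^+ 3 + c2%:~R * 'X ^+ 2 + c1%:~R * 'X + c0%:~R ->
  horner_mx S q i j
  = c3 * (S ^+ 3) i j + c2 * (S ^+ 2) i j + c1 * S i j + c0 * (i == j)%:R.
Proof.
move=> ->; have intE c (X : 'M[int]_n.+1) : (c%:~R * X) i j = c * X i j.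
  by rewrite mulrzl -scaler_int mxE intz.
rewrite !(rmorphD, rmorphXn, rmorphM) /= horner_mx_X !rmorph_int.
have addE (X Y : 'M[int]_n.+1) : (X + Y) i j = X i j + Y i j by rewrite mxE.
have oneE : (1 : 'M[int]_n.+1) i j = (i == j)%:R by rewrite mxE.
by rewrite !addE !intE -[c0%:~R]mulr1 intE oneE.
Qed.

Section SeidelMod8.

Variables (n : nat) (S : 'M[int]_n.+1).
Hypotheses (seidelS : seidel_matrix S) (n50 : n.+1 = 50%N).

Let n50z : n.+1%:Z = 50.
Proof. by rewrite n50. Qed.

Let a i j : int := ((i != j) && (S i j == -1))%:R.

Let S_a i j : S i j = 1 - 2 * a i j - (i == j)%:R.
Proof.
rewrite /a; have [_ S0 S1] := seidelS.
have [->|ij] /= := eqVneq i j; first by rewrite S0.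
by have [->|->] := S1 i j ij.
Qed.

Let S_sym i j : S i j = S j i.
Proof. by have [symS _ _] := seidelS; rewrite -[in LHS]symS mxE. Qed.

Let a_sym i j : a i j = a j i.
Proof. by rewrite /a eq_sym S_sym. Qed.

Lemma seidel_square_diag i : (S ^+ 2) i i = 49.
Proof.
rewrite expr2 mxE (bigD1 i) //= {1}S_a /a eqxx /= mulr0 subr0 subrr mul0r add0r.
rewrite (eq_bigr (fun=> 1)) => [|k ki].
  by rewrite sumr_const cardC1 card_ord; move: n50 => [->].
rewrite (S_sym k i); have [_ _ S1] := seidelS.
have ik : i != k by rewrite eq_sym.
by have [->|->] := S1 i k ik.
Qed.

(** Adding the identity fills the diagonal with 1, giving a full sign matrix to which the
    congruences apply. *)
Let T := horner_mx S ('X + 1).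

Let TE i j : T i j = 1 - 2 * a i j.
Proof. by rewrite /T rmorphD /= horner_mx_X rmorph1 !mxE S_a subrK. Qed.

Let T2E i j : (T ^+ 2) i j = (S ^+ 2) i j + 2 * S i j + (i == j)%:R.
Proof.
rewrite -rmorphXn /= (@horner_mx_cubicE _ _ _ 0 1 2 1); last by ring.
by rewrite mul0r add0r !mul1r.
Qed.

Let T3E i j : (T ^+ 3) i j
  = (S ^+ 3) i j + 3 * (S ^+ 2) i j + 3 * S i j + (i == j)%:R.
Proof.
rewrite -rmorphXn /= (@horner_mx_cubicE _ _ _ 1 3 3 1); last by ring.
by rewrite !mul1r.
Qed.

Lemma seidel_mod8 : exists (d : 'I_n.+1 -> int) (e : int),
  (forall i, exists z, (S ^+ 3) i i = 2 * e + 4 * d i + 8 * z) /\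
  (forall i j, i != j -> exists z, 2 * (S ^+ 2) i j = 4 * (d i + d j) + 8 * z).
Proof.
pose d i := \sum_j a i j.
exists d, (- \sum_j d j); split=> [i|i j ij].
  have := T3E i i; rewrite eqxx seidel_square_diag; have [_ -> _] := seidelS.
  have [z] := sign_cube_mod8 a_sym i; rewrite -/(d i) n50z.
  have -> : (T ^+ 3) i i
      = \sum_j \sum_k (1 - 2 * a i j) * (1 - 2 * a j k) * (1 - 2 * a k i).
    rewrite exprS mxE; apply: eq_bigr => j _.
    by rewrite expr2 mxE mulr_sumr; apply: eq_bigr => k _; rewrite mulrA !TE.
  (* Parity of squares turns 4 d_i^2 into 4 d_i modulo 8. *)
  have [w ->] := sqr_mod2 (d i).
  by move=> -> eqS; exists (294 + z + w - 25 * d i); move: (\sum_j _) eqS => x; lia.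
have := T2E i j; rewrite (negPf ij) addr0.
have [z] := sign_square_mod4 a i j; rewrite -/(d i) -/(d j) n50z.
have -> : (T ^+ 2) i j = \sum_k (1 - 2 * a i k) * (1 - 2 * a j k).
  rewrite expr2 mxE; apply: eq_bigr => k _.
  by rewrite !TE (a_sym k).
move=> -> eqS; rewrite (S_a i j) (negPf ij) in eqS.
exists (z + a i j + 12 - (d i + d j)); lia.
Qed.

End SeidelMod8.

(** * The scaled projections M and K of an integer Seidel matrix *)

Lemma trmx_horner_mx (R : comNzRingType) n (S : 'M[R]_n.+1) (q : {poly R}) :
  (horner_mx S q)^T = horner_mx S^T q.
Proof.
elim/poly_ind: q => [|q c IH]; first by rewrite !rmorph0 trmx0.
rewrite [in RHS]mulrC !rmorphD !rmorphM /= !horner_mx_X !horner_mx_C raddfD /=.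
by rewrite tr_scalar_mx trmx_mul IH.
Qed.

Section IntSeidel.

Variables (n : nat) (S : 'M[int]_n.+1).
Hypothesis seidelS : seidel_matrix S.
Let rs : seq int := nseq 33 (-5) ++ 7 :: nseq 9 9 ++ nseq 7 11.
Hypothesis charS : char_poly S = \prod_(z <- rs) ('X - z%:P).

Let n50 : n.+1 = 50%N.
Proof.
by have := size_char_poly S; rewrite charS size_prod_XsubC => /succn_inj <-.
Qed.

Let symS : S^T = S.
Proof. by case: seidelS. Qed.

Let qM : {poly int} := ('X + 5) * ('X - 9) * ('X - 11).
Let qK : {poly int} := - ('X + 5) * ('X - 7) * ('X - 11).
Let M := horner_mx S qM.
Let K := horner_mx S qK.

Let symM : M^T = M.
Proof. by rewrite trmx_horner_mx symS. Qed.

Let symK : K^T = K.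
Proof. by rewrite trmx_horner_mx symS. Qed.

Let ME i j :
  M i j = (S ^+ 3) i j - 15 * (S ^+ 2) i j - S i j + 495 * (i == j)%:R.
Proof.
rewrite /M (@horner_mx_cubicE _ _ _ 1 (-15) (-1) 495); last by rewrite /qM; ring.
by ring.
Qed.

Let KE i j :
  K i j = - (S ^+ 3) i j + 13 * (S ^+ 2) i j + 13 * S i j - 385 * (i == j)%:R.
Proof.
rewrite /K (@horner_mx_cubicE _ _ _ (-1) 13 13 (-385)); last by rewrite /qK; ring.
by ring.
Qed.

Let hornerME (z : int) : qM.[z] = (z + 5) * (z - 9) * (z - 11).
Proof. by rewrite /qM !hornerE. Qed.

Let hornerKE (z : int) : qK.[z] = - (z + 5) * (z - 7) * (z - 11).
Proof. by rewrite /qK !hornerE. Qed.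

Let trM : \tr M = 96.
Proof.
rewrite /M (int_trace_horner_mx symS charS) /rs.
by under eq_bigr do rewrite hornerME; rewrite unlock.
Qed.

Let horner_eq0 (q : {poly int}) :
  q.[-5] = 0 -> q.[7] = 0 -> q.[9] = 0 -> q.[11] = 0 -> horner_mx S q = 0.
Proof.
move=> q1 q2 q3 q4; apply: (int_horner_mx_roots_eq0 symS charS).
by rewrite /rs /= /root q1 q2 q3 q4 eqxx.
Qed.

Let sqM : M *m M = 96 *: M.
Proof.
apply/eqP; rewrite -subr_eq0 -[M *m M]/(M * M) /M -linearZ -rmorphM -rmorphB /=.
by apply/eqP/horner_eq0; rewrite hornerD hornerN hornerZ hornerM hornerME; ring.
Qed.

Let sqK : K *m K = 56 *: K.
Proof.
apply/eqP; rewrite -subr_eq0 -[K *m K]/(K * K) /K -linearZ -rmorphM -rmorphB /=.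
by apply/eqP/horner_eq0; rewrite hornerD hornerN hornerZ hornerM hornerKE; ring.
Qed.

Let KM0 : K *m M = 0.
Proof.
rewrite -[K *m M]/(K * M) /K /M -rmorphM /=.
by apply/horner_eq0; rewrite hornerM hornerME hornerKE; ring.
Qed.

Lemma int_seidel_false : False.
Proof.
have [_ S0 S1] := seidelS.
have Mdiag i : M i i = (S ^+ 3) i i - 240.
  by rewrite ME seidel_square_diag // S0 eqxx; lia.
have Kdiag i : K i i = 12 - M i i.
  by rewrite Mdiag KE seidel_square_diag // S0 eqxx; lia.
have Mii_ge0 i := scaled_proj_diag_ge0 symM sqM isT i.
have Mii_le12 i : M i i <= 12.
  by rewrite -subr_ge0 -Kdiag; apply: (scaled_proj_diag_ge0 symK sqK).
have sumM : \sum_i M i i = 96 by rewrite -trM.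
have [d [e [S3 S2]]] := seidel_mod8 seidelS n50.
(* Otherwise all M i i = 2 mod 4, so they are at least 2 and sum to at least 100. *)
have [e' eE] : exists e', e = 2 * e'.
  exists (e %/ 2)%Z; suff : (e %% 2)%Z != 1 by lia.
  apply/eqP => e1; have : \sum_(i < n.+1) 2 <= \sum_i M i i.
    apply: ler_sum => i _; have [z] := S3 i; have := Mii_ge0 i.
    by rewrite Mdiag; lia.
  by rewrite sumM sumr_const card_ord n50.
pose mu i := (M i i %/ 4)%Z.
have muE i : M i i = 4 * mu i.
  by rewrite /mu; have [z] := S3 i; rewrite Mdiag; lia.
pose P := \matrix_(i, j) (M i j %/ 4)%Z.
have PE i j : M i j = 4 * P i j /\ P i j ^+ 2 = mu i * mu j.
  have := scaled_proj_rank1 symM sqM isT i j trM; rewrite !muE mxE.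
  move: (M i j) (mu i) (mu j) => x u v xE.
  have [q [r [xq rB]]] : exists q r, x = 4 * q + r /\ 0 <= r <= 3.
    by exists (x %/ 4)%Z, (x %% 4)%Z; lia.
  have sq : 16 * q ^+ 2 + 8 * (q * r) + r ^+ 2 = 16 * (u * v).
    by transitivity (x ^+ 2); [rewrite xq; ring | rewrite xE; ring].
  (* Reducing [sq] modulo 8 excludes r = 1 and 3; for r = 2 it would read 4 = 0 modulo 16. *)
  have r0 : r = 0.
    move: (q ^+ 2) (u * v) sq => y w sq.
    by have [|[|[|]]] : r = 0 \/ r = 1 \/ r = 2 \/ r = 3; [lia|..];
      move=> rE //; move: sq; rewrite rE; lia.
  rewrite xq r0 addr0 mulKz //; split=> //.
  by move: sq; rewrite r0 mulr0; lia.
pose G := \matrix_(i, j) (K i j %/ 4)%Z.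
have GE i j : K i j = 4 * G i j /\ exists z, G i j = (1 + mu i) * (1 + mu j) + 2 * z.
  rewrite mxE; have [->|ij] := eqVneq i j.
    have -> : K j j = 4 * (3 - mu j) by rewrite Kdiag muE; ring.
    rewrite mulKz //; split=> //.
    have [w] := sqr_mod2 (mu j); rewrite expr2 => wE.
    by exists (1 - 2 * mu j - w); rewrite mulrDl mul1r mulrDr wE; lia.
  have [Mij Pij] := PE i j.
  have [z S2ij] := S2 i j ij.
  have [w wE] := sqr_mod2 (P i j).
  have [zi Si] := S3 i; have [zj Sj] := S3 j.
  have [u uE] : exists u, S i j = 2 * u + 1.
    by have [->|->] := S1 i j ij; [exists 0 | exists (-1)].
  (* The cubes cancel in K + M = -2 (S + 5)(S - 11). *)
  have KMij : K i j = - (2 * (S ^+ 2) i j) + 12 * S i j - M i j.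
    by rewrite KE ME (negPf ij); lia.
  have KG : K i j = 4 * (- (d i + d j) - 2 * z + 3 * S i j - P i j).
    by rewrite KMij S2ij Mij; lia.
  rewrite KG mulKz //; split=> //.
  have mui := muE i; have muj := muE j.
  rewrite Mdiag Si eE in mui; rewrite Mdiag Sj eE in muj.
  (* Modulo 2, mu_i = e' + d_i, so d_i + d_j = mu_i + mu_j; also P_ij = P_ij^2 = mu_i mu_j and S_ij
     = 1. These add up to the product. *)
  have -> : (1 + mu i) * (1 + mu j) = 1 + mu j + (mu i + (P i j + 2 * w)).
    by rewrite -wE Pij; ring.
  exists (e' + zi + zj - 60 - z + 3 * u + 1 - w - P i j - mu i - mu j).
  rewrite uE; move: (mu i) (mu j) (P i j) (d i) (d j) mui muj => x y p di dj.
  by lia.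
have KG : K = 4 *: G by apply/matrixP => i j; rewrite mxE; have [] := GE i j.
have MP : M = 4 *: P by apply/matrixP => i j; rewrite mxE; have [] := PE i j.
have symG : G^T = G by apply/matrixP => i j; rewrite !mxE -[in LHS]symK mxE.
have symP : P^T = P by apply/matrixP => i j; rewrite !mxE -[in LHS]symM mxE.
apply: (@odd_gram_false n.+1 G P mu) => //.
- have := sqK; rewrite KG -scalemxAl -scalemxAr !scalerA => /matrixP GG.
  by apply/matrixP => i j; have := GG i j; rewrite !mxE; lia.
- move=> i j; transitivity ((G *m P) i j).
    rewrite [in RHS]mxE; apply: eq_bigr => k _; congr (_ * _).
    by rewrite -[in LHS]symP [in LHS]mxE.
  have /matrixP/(_ i j)/eqP := KM0.
  by rewrite KG MP -scalemxAl -scalemxAr scalerA !mxE mulf_eq0 => /eqP.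
- by move=> i; have := Mii_ge0 i; have := Mii_le12 i; rewrite muE; move: (mu i); lia.
- have := sumM; under eq_bigr do rewrite muE.
  by rewrite -mulr_sumr; move: (\sum_i mu i); lia.
- by move=> i j; have [] := PE i j.
- by move=> i; have [+ _] := GE i i; rewrite Kdiag muE; move: (G i i) (mu i); lia.
- by move=> i j; have [] := GE i j.
Qed.

End IntSeidel.

(** * Reduction from [R] to the integers *)

Lemma prod_nseq_cons (A : comNzRingType) (I : Type) (F : I -> A)
    (a b c : nat) (x y z t : I) :
  \prod_(i <- nseq a x ++ y :: nseq b z ++ nseq c t) F i
  = F x ^+ a * F y * F z ^+ b * F t ^+ c.
Proof. by rewrite big_cat big_cons big_cat /= !big_nseq !iter_mulr_1 !mulrA. Qed.

Theorem theorem5p9 (R : numDomainType) :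
  ~ exists (n : nat) (S : 'M[R]_n),
      seidel_matrix S /\
      char_poly S =
        ('X + 5%:P) ^+ 33 * ('X - 7%:P) * ('X - 9%:P) ^+ 9 * ('X - 11%:P) ^+ 7.
Proof.
case=> -[|n] [S [seidelS charS]].
  (* In order 0 the characteristic polynomial is 1, but the right-hand side vanishes at 7. *)
  move: (_ ^+ 33) (_ ^+ 9) (_ ^+ 7) charS => A B C.
  rewrite -!mulrA mulrCA /char_poly det_mx00 => /(congr1 (horner^~ 7))/eqP.
  by rewrite hornerM hornerXsubC subrr mul0r hornerC oner_eq0.
have [symS S0 S1] := seidelS.
(* The entries of [S] are 0 or +-1, so [S] lifts to an integer matrix; injectivity of [intr] lets
   the characteristic polynomial descend. *)
pose SZ : 'M[int]_n.+1 := \matrix_(i, j)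
  (if i == j then 0 else if S i j == 1 then 1 else -1).
have SE : S = map_mx intr SZ.
  apply/matrixP => i j; rewrite !mxE; have [->|ij] := eqVneq i j; first by rewrite S0.
  have [->|->] := S1 i j ij; first by rewrite eqxx.
  by rewrite -subr_eq0 -opprD oppr_eq0 (pnatr_eq0 _ 2).
apply: (@int_seidel_false n SZ).
  split=> [|i|i j ij].
  - by apply/matrixP => i j; rewrite !mxE eq_sym -[in LHS]symS mxE.
  - by rewrite mxE eqxx.
  - by rewrite mxE (negPf ij); case: ifP; [left | right].
have intr_poly_inj : injective (map_poly (intr : int -> R)).
  move=> p q /polyP eqpq; apply/polyP => i; apply: (@intr_inj R).
  by have := eqpq i; rewrite !coef_map.
apply: intr_poly_inj; rewrite map_char_poly -SE charS.
by rewrite rmorph_prod prod_nseq_cons /= !map_polyXsubC !rmorphN /= opprK !rmorph_nat.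
Qed.
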